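(* Let $b>0$ and let $f\colon[0,b]\to\mathbb{R}$ be continuous and strictly increasing with $f(0)=0$, and let $B=f(b)$, $g=f^{-1}$, $r$, $q$, $\mathcal{Q}$ and the projection $\Pi_{\mathcal{Q}}$ be constructed from $f$ as in the context. Assume that for all $c\in\mathbb{R}$ $$\lim_{y\searrow0}\frac{f\big(y+c\,y\,(y+f(y))\big)}{f(y)}=1.$$ Let $y\in\mathbb{R}$ with $y\to0$, let $x=x(y)\in\mathbb{R}$ with $x=O(y)$, and let $t_y\in[-B,B]$ be such that $\Pi_{\mathcal{Q}}((x,y)')=q(t_y)$. Then, as $y\to0$, $$t_y=f(y)+o(f(y))\qquad\text{and}\qquad\Pi_{\mathcal{Q}}\left(\begin{pmatrix} x \\ y \end{pmatrix}\right)=\begin{pmatrix} 1 \\ f(y) \end{pmatrix}+o(f(y)),$$ where $f$ is extended to $[-b,b]$ as an odd function, $f(-y):=-f(y)$. Furthermore, if $x=0$ (for all $y$), the same conclusions hold with the limit assumption above replaced by the assumption that for all $c\in\mathbb{R}$ $$\lim_{y\searrow0}\frac{f\big(y+c\,y\,f(y)\,(y+f(y))\big)}{f(y)}=1.$$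
   Context: Construction of $\mathcal{Q}=\mathcal{Q}_f$: Let $b>0$ and let $f\colon[0,b]\to\mathbb{R}$ be continuous and strictly increasing with $f(0)=0$. Set $B:=f(b)$ and let $g:=f^{-1}\colon[0,B]\to[0,b]$ be the inverse function. For $t\in[0,B]$ put $r(t):=1+\int_0^tg(x)\,\mathrm{d}x$. For $t\in[-B,B]$ put $q(t):=r(|t|)\,(\cos t,\sin t)'$, and let $\mathcal{Q}:=\{q(t):t\in[-B,B]\}\subset\mathbb{R}^2$, which is compact. The prime on a vector denotes transposition and $\Vert\cdot\Vert$ is the Euclidean norm. Projection: for $z\in\mathbb{R}^2$, $\Pi_{\mathcal{Q}}(z)$ denotes an element of $\operatorname{arg\,min}_{p\in\mathcal{Q}}\Vert z-p\Vert$ (nonempty by compactness); if the minimizer is not unique, one element of the argmin set is chosen by a fixed arbitrary mechanism, e.g. smallest in lexicographic order. $x=O(y)$ means that there is a constant $L$ with $|x(y)|\le L|y|$ for all $y$ sufficiently close to $0$; $o(f(y))$ denotes a (scalar or vector) quantity whose norm divided by $|f(y)|$ tends to $0$ as $y\to0$. *)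

(* Defs.v *)
From Stdlib Require Import Reals ClassicalEpsilon.
From Coquelicot Require Import Coquelicot.
Open Scope R_scope.

(* Inverse of f : [0,b] -> [f 0, f b]; the value is arbitrary at points outside
   the image of [0,b]. *)
Definition inverse_on (b : R) (f : R -> R) (t : R) : R :=
  epsilon (inhabits 0) (fun x => 0 <= x <= b /\ f x = t).

Definition radius (b : R) (f : R -> R) (t : R) : R :=
  1 + RInt (inverse_on b f) 0 t.

Definition curve (b : R) (f : R -> R) (t : R) : R * R :=
  (radius b f (Rabs t) * cos t, radius b f (Rabs t) * sin t).

Definition curve_set (b : R) (f : R -> R) (p : R * R) : Prop :=
  exists t, - f b <= t <= f b /\ p = curve b f t.

(* On R * R, Coquelicot's [norm] is the Euclidean norm (see [prod_norm]). *)
Definition is_argmin_dist (Q : R * R -> Prop) (z p : R * R) : Prop :=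
  Q p /\ forall p', Q p' -> norm (minus z p) <= norm (minus z p').

(* Pi selects, for every z, one nearest point of Q; the way ties are broken is
   left arbitrary. *)
Definition is_projection (Q : R * R -> Prop) (Pi : R * R -> R * R) : Prop :=
  forall z, is_argmin_dist Q z (Pi z).

(* Odd extension of the restriction of f to nonnegative arguments. *)
Definition odd_ext (f : R -> R) (y : R) : R :=
  if Rle_dec 0 y then f y else - f (- y).

Definition big_O_id (x : R -> R) : Prop :=
  exists L, locally 0 (fun y => Rabs (x y) <= L * Rabs y).

(* e = o(h) at 0, for a scalar- or vector-valued e; [is_lim] at 0 is a limit
   over y <> 0. *)
Definition little_o {V : NormedModule R_AbsRing} (e : R -> V) (h : R -> R) : Prop :=
  is_lim (fun y => norm (e y) / Rabs (h y)) 0 0.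

(* Main.v *)
Require Import Defs.
From Stdlib Require Import Reals Lra ClassicalEpsilon ssreflect.
From Coquelicot Require Import Coquelicot.
Open Scope R_scope.

(** Let [F] be the odd extension of [f] to a homeomorphism of the whole line and
    [G] its inverse.  The curve is then [t |-> R(t) (cos t, sin t)] with the
    globally C^1 even function [R(t) = 1 + int_0^t G], so that no case
    distinction at [t = 0] is needed.  Up to a constant, the squared distance
    from [(x, y)] to the curve is [R^2 - 2 R (x cos t + y sin t)] ([offset]).

    As [R > 1] away from [0], a nearest parameter [t] tends to [0] with [(x, y)]
    ([minimizer_small]).  It is therefore an interior critical point, i.e.
      [G(t) (R - x cos t - y sin t) = R (y cos t - x sin t)].
    With [x = O(y)] this says that [u := G(t)] is close to [y]:
      [|u - y| <= C y t^k (y + t)],    [t = F(u)],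
    with [k = 0] in general, and with [k = 1] when [x = 0], because the terms
    [u x cos t] and [x sin t], of order [y^2] and [y t], then disappear
    ([critical_estimate]).

    It remains to deduce [F(u) ~ F(y)] from the hypothesis that [F] hardly
    changes between [w] and [w + c w F(w)^k (w + F(w))].  The difficulty is that
    the error bound involves the unknown [t = F(u)] and not [F(y)], and that [F]
    may grow arbitrarily fast.  The way out is to apply the hypothesis not at
    [y] but at the point [w] whose stretched image is the larger of [u] and [y]:
    if the smaller of the two were below [w], the distance [|u - y|] would be at
    least [c w F(w)^k (w + F(w))], which exceeds the error bound for large [c];
    so the smaller one is at least [w], where [F] is almost as large as at the
    larger one ([stretch_transfer]).

    For [y < 0] the reflection [(x, y, t) |-> (x, -y, -t)] applies, and the
    position of the projected point follows from
    [R - 1 <= t G(t)] and the Taylor bounds for [cos] and [sin]. *)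

(** * Odd extension of the profile to a homeomorphism of the line *)

(** [G] is only asked to be a right inverse of [F]; that it is a left inverse and
    that the roles of [F] and [G] can be exchanged is [odd_homeo_sym]. *)
Record odd_homeo (F G : R -> R) : Prop := {
  oh_cont : forall u, continuous F u;
  oh_incr : forall u v, u < v -> F u < F v;
  oh_odd : forall u, F (- u) = - F u;
  oh_FG : forall t, F (G t) = t }.

Definition clamp (b u : R) : R := Rmax 0 (Rmin u b).

(** One formula for the odd function that agrees with [f] on [[0, b]] and
    continues it with slope 1 beyond [b], so that continuity and oddness can be
    read off without gluing. *)
Definition extend (b : R) (f : R -> R) (u : R) : R :=
  f (clamp b u) - f (clamp b (- u)) + (u - clamp b u + clamp b (- u)).

Lemma clamp_range b u : 0 < b -> 0 <= clamp b u <= b.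
Proof.
  intros Hb; unfold clamp, Rmax, Rmin.
  destruct (Rle_dec u b); destruct (Rle_dec 0 _); lra.
Qed.

Lemma clamp_id b u : 0 <= u <= b -> clamp b u = u.
Proof.
  intros Hu; unfold clamp, Rmax, Rmin.
  destruct (Rle_dec u b); destruct (Rle_dec 0 _); lra.
Qed.

Lemma clamp_nonpos b u : 0 < b -> u <= 0 -> clamp b u = 0.
Proof.
  intros Hb Hu; unfold clamp, Rmax, Rmin.
  destruct (Rle_dec u b); destruct (Rle_dec 0 _); lra.
Qed.

Lemma clamp_top b u : 0 < b -> b <= u -> clamp b u = b.
Proof.
  intros Hb Hu; unfold clamp, Rmax, Rmin.
  destruct (Rle_dec u b); destruct (Rle_dec 0 _); lra.
Qed.

Lemma clamp_lipschitz b u v : 0 < b -> Rabs (clamp b u - clamp b v) <= Rabs (u - v).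
Proof.
  intros Hb; unfold clamp, Rmax, Rmin.
  repeat (destruct (Rle_dec _ _)); unfold Rabs; repeat (destruct (Rcase_abs _)); lra.
Qed.

Lemma clamp_continuous (b u : R) : 0 < b -> continuous (clamp b) u.
Proof.
  intros Hb.
  apply filterlim_locally; intros eps; exists eps; intros v Hv.
  apply Rle_lt_trans with (2 := Hv), clamp_lipschitz, Hb.
Qed.

Lemma clamp_comp_continuous (b : R) (f : R -> R) (u : R) : 0 < b ->
  continuous_on (fun u => 0 <= u <= b) f -> continuous (fun v => f (clamp b v)) u.
Proof.
  intros Hb Hf.
  refine (filterlim_comp _ _ _ (clamp b) f _ _ _ _ (Hf (clamp b u) (clamp_range b u Hb))).
  intros P HP; unfold filtermap.
  apply (filter_imp (fun v => 0 <= clamp b v <= b -> P (clamp b v))).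
  - intros v Hv; apply Hv, clamp_range, Hb.
  - exact (clamp_continuous b u Hb (fun w => 0 <= w <= b -> P w) HP).
Qed.

Lemma extend_odd (b : R) (f : R -> R) (u : R) : extend b f (- u) = - extend b f u.
Proof. unfold extend; rewrite Ropp_involutive; ring. Qed.

Lemma extend_nonneg (b : R) (f : R -> R) (u : R) : 0 < b -> f 0 = 0 -> 0 <= u ->
  extend b f u = f (clamp b u) + (u - clamp b u).
Proof.
  intros Hb f0 Hu; unfold extend.
  rewrite (clamp_nonpos b (- u)) ?f0; lra.
Qed.

Lemma extend_eq (b : R) (f : R -> R) (u : R) : 0 < b -> f 0 = 0 -> 0 <= u <= b -> extend b f u = f u.
Proof.
  intros Hb f0 Hu; rewrite extend_nonneg // ?clamp_id //; lra.
Qed.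

Lemma extend_odd_ext (b : R) (f : R -> R) (u : R) : 0 < b -> f 0 = 0 -> Rabs u <= b ->
  extend b f u = odd_ext f u.
Proof.
  intros Hb f0 Hu; apply Rabs_le_between in Hu; unfold odd_ext.
  destruct (Rle_dec 0 u).
  - apply extend_eq; lra.
  - rewrite -{1}(Ropp_involutive u) extend_odd extend_eq //; lra.
Qed.

Lemma continuous_opp_arg (h : R -> R) u :
  continuous h (- u) -> continuous (fun v => h (- v)) u.
Proof.
  intros Hh; apply (continuous_comp Ropp h); [|exact Hh].
  apply (continuous_opp (fun v : R => v)), continuous_id.
Qed.

Lemma extend_continuous (b : R) (f : R -> R) (u : R) : 0 < b ->
  continuous_on (fun u => 0 <= u <= b) f -> continuous (extend b f) u.
Proof.
  intros Hb Hf; unfold extend.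
  apply (continuous_plus (V := R_NormedModule)).
  - apply (continuous_minus (V := R_NormedModule)).
    + apply clamp_comp_continuous; assumption.
    + apply (continuous_opp_arg (fun v => f (clamp b v))), clamp_comp_continuous; assumption.
  - apply (continuous_plus (V := R_NormedModule)).
    + apply (continuous_minus (V := R_NormedModule)).
      * apply continuous_id.
      * apply clamp_continuous, Hb.
    + apply continuous_opp_arg, clamp_continuous, Hb.
Qed.

Lemma extend_incr_nonneg (b : R) (f : R -> R) (u v : R) : 0 < b -> f 0 = 0 ->
  (forall u v, 0 <= u -> u < v -> v <= b -> f u < f v) ->
  0 <= u -> u < v -> extend b f u < extend b f v.
Proof.
  intros Hb f0 Hf Hu Huv.
  rewrite !extend_nonneg; try lra.
  destruct (Rle_dec v b) as [Hv|Hv].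
  - rewrite !clamp_id; try lra. specialize (Hf u v); lra.
  - rewrite (clamp_top b v); try lra.
    destruct (Rlt_dec u b) as [Hub|Hub].
    + rewrite clamp_id; [specialize (Hf u b)|]; lra.
    + rewrite clamp_top; lra.
Qed.

Lemma extend_incr (b : R) (f : R -> R) (u v : R) : 0 < b -> f 0 = 0 ->
  (forall u v, 0 <= u -> u < v -> v <= b -> f u < f v) ->
  u < v -> extend b f u < extend b f v.
Proof.
  intros Hb f0 Hf Huv.
  assert (H0 : extend b f 0 = 0) by (rewrite extend_eq //; lra).
  assert (Hn : forall w, w < 0 -> extend b f w < 0).
  { intros w Hw; assert (H := extend_incr_nonneg b f 0 (- w) Hb f0 Hf ltac:(lra) ltac:(lra)).
    rewrite extend_odd in H; lra. }
  destruct (Rle_dec 0 u) as [Hu|Hu].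
  - apply extend_incr_nonneg; assumption.
  - destruct (Rle_dec v 0) as [Hv|Hv].
    + assert (H := extend_incr_nonneg b f (- v) (- u) Hb f0 Hf ltac:(lra) ltac:(lra)).
      rewrite !extend_odd in H; lra.
    + assert (H1 := Hn u ltac:(lra)).
      assert (H2 := extend_incr_nonneg b f 0 v Hb f0 Hf ltac:(lra) ltac:(lra)). lra.
Qed.

(** The slope 1 beyond [b] makes [extend b f] exceed [|t|] at [b + |t|], and the
    intermediate value theorem does the rest. *)
Lemma extend_surj (b : R) (f : R -> R) (t : R) : 0 < b -> f 0 = 0 ->
  continuous_on (fun u => 0 <= u <= b) f ->
  (forall u v, 0 <= u -> u < v -> v <= b -> f u < f v) ->
  exists u, extend b f u = t.
Proof.
  intros Hb f0 Hc Hf.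
  set (a := b + Rabs t).
  assert (Ht := Rle_abs t). assert (Ht' := Rle_abs (- t)). rewrite Rabs_Ropp in Ht'.
  assert (Ha : Rabs t < extend b f a).
  { assert (Hp := Rabs_pos t).
    rewrite extend_nonneg ?clamp_top; unfold a; try lra.
    specialize (Hf 0 b); lra. }
  destruct (IVT_gen (extend b f) (- a) a t) as [u [_ Hu]].
  - intros u; apply continuity_pt_filterlim, (extend_continuous b f u Hb Hc).
  - rewrite extend_odd Rmin_left ?Rmax_right; lra.
  - exists u; exact Hu.
Qed.

Lemma extend_odd_homeo (b : R) (f : R -> R) : 0 < b -> f 0 = 0 ->
  continuous_on (fun u => 0 <= u <= b) f ->
  (forall u v, 0 <= u -> u < v -> v <= b -> f u < f v) ->
  exists G, odd_homeo (extend b f) G.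
Proof.
  intros Hb f0 Hc Hf.
  exists (fun t => epsilon (inhabits 0) (fun u => extend b f u = t)).
  split.
  - intros u; apply extend_continuous; assumption.
  - intros u v; apply extend_incr; assumption.
  - intros u; apply extend_odd.
  - intros t; apply (epsilon_spec (inhabits 0) (fun u => extend b f u = t)).
    apply extend_surj; assumption.
Qed.

Lemma oh_0 F G : odd_homeo F G -> F 0 = 0.
Proof. intros H; assert (E := oh_odd F G H 0); rewrite Ropp_0 in E; lra. Qed.

Lemma oh_le F G u v : odd_homeo F G -> u <= v -> F u <= F v.
Proof.
  intros H [Huv| ->]; [left; apply (oh_incr F G H), Huv | right; reflexivity].
Qed.

Lemma oh_lt_inv F G u v : odd_homeo F G -> F u < F v -> u < v.
Proof.
  intros H Huv; apply Rnot_le_lt; intros Hvu.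
  apply (oh_le F G) in Hvu; [lra|exact H].
Qed.

Lemma oh_GF F G u : odd_homeo F G -> G (F u) = u.
Proof.
  intros H; assert (E := oh_FG F G H (F u)).
  destruct (Rtotal_order (G (F u)) u) as [L|[L|L]]; [|exact L|];
  apply (oh_incr F G H) in L; lra.
Qed.

(** The inverse of a strictly increasing bijection is continuous: [G] maps the
    interval from [F (G t - eps)] to [F (G t + eps)], which has [t] in its
    interior, into the [eps]-neighbourhood of [G t]. *)
Lemma odd_homeo_sym F G : odd_homeo F G -> odd_homeo G F.
Proof.
  intros H.
  assert (Hlt : forall s t, s < t -> G s < G t).
  { intros s t Hst; apply (oh_lt_inv F G) with (1 := H).
    rewrite !(oh_FG F G H); exact Hst. }
  split; [|exact Hlt| |intros; apply (oh_GF F G); exact H].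
  - intros t; apply filterlim_locally; intros eps.
    assert (He := cond_pos eps).
    assert (H1 := oh_incr F G H (G t - eps) (G t) ltac:(lra)).
    assert (H2 := oh_incr F G H (G t) (G t + eps) ltac:(lra)).
    rewrite (oh_FG F G H) in H1, H2.
    exists (mkposreal _ (Rmin_pos _ _ (proj2 (Rlt_0_minus _ _) H1) (proj2 (Rlt_0_minus _ _) H2))).
    intros s Hs; apply Rabs_lt_between in Hs; cbn in Hs.
    assert (L1 := Rmin_l (t - F (G t - eps)) (F (G t + eps) - t)).
    assert (L2 := Rmin_r (t - F (G t - eps)) (F (G t + eps) - t)).
    unfold minus, plus, opp in Hs; cbn in Hs.
    apply Rabs_lt_between; unfold minus, plus, opp; cbn.
    assert (K1 : G t - eps < G s)
      by (apply (oh_lt_inv F G) with (1 := H); rewrite (oh_FG F G H); lra).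
    assert (K2 : G s < G t + eps)
      by (apply (oh_lt_inv F G) with (1 := H); rewrite (oh_FG F G H); lra).
    lra.
  - intros t.
    rewrite -{1}(oh_FG F G H t) -(oh_odd F G H) (oh_GF F G) //.
Qed.

(** * The radius and the distance to the curve *)

Definition rad (G : R -> R) (t : R) : R := 1 + RInt G 0 t.

Lemma rad_derive F G t : odd_homeo F G -> is_derive (rad G) t (G t).
Proof.
  intros H.
  assert (Hc := oh_cont G F (odd_homeo_sym F G H)).
  unfold rad; rewrite -(Rplus_0_l (G t)).
  apply (is_derive_plus (fun _ => 1) (fun t => RInt G 0 t)).
  - exact (is_derive_const 1 t).
  - apply (is_derive_RInt G (fun t => RInt G 0 t) 0); [|apply Hc].
    apply filter_forall; intros s.
    apply (RInt_correct (V := R_CompleteNormedModule)),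
      (ex_RInt_continuous (V := R_CompleteNormedModule)); auto.
Qed.

Lemma rad_0 G : rad G 0 = 1.
Proof. unfold rad; rewrite RInt_point; unfold zero; cbn; ring. Qed.

Lemma rad_even F G t : odd_homeo F G -> rad G (- t) = rad G t.
Proof.
  intros H; unfold rad; f_equal.
  assert (Hc := oh_cont G F (odd_homeo_sym F G H)).
  symmetry; apply is_RInt_unique.
  apply (is_RInt_ext (fun s => opp (G (- s)))).
  - intros s _; rewrite (oh_odd G F (odd_homeo_sym F G H)); unfold opp; cbn; ring.
  - apply (is_RInt_comp_opp G); rewrite Ropp_0.
    apply (RInt_correct (V := R_CompleteNormedModule)),
      (ex_RInt_continuous (V := R_CompleteNormedModule)); auto.
Qed.

Lemma rad_mvt F G s t : odd_homeo F G -> s < t ->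
  exists c, s < c < t /\ rad G t - rad G s = G c * (t - s).
Proof.
  intros H Hst.
  destruct (MVT_cor2 (rad G) G s t Hst) as [c [E Hc]].
  - intros c _; apply is_derive_Reals, (rad_derive F), H.
  - exists c; split; assumption.
Qed.

Lemma rad_incr F G s t : odd_homeo F G -> 0 <= s -> s < t -> rad G s < rad G t.
Proof.
  intros H Hs Hst.
  destruct (rad_mvt F G s t H Hst) as [c [Hc E]].
  assert (Hc0 := oh_incr G F (odd_homeo_sym F G H) 0 c ltac:(lra)).
  rewrite (oh_0 G F (odd_homeo_sym F G H)) in Hc0. nra.
Qed.

Lemma rad_bounds F G t : odd_homeo F G -> 0 <= t -> 1 <= rad G t <= 1 + t * G t.
Proof.
  intros H [Ht| <-]; [|rewrite rad_0; lra].
  assert (H1 := rad_incr F G 0 t H ltac:(lra) Ht).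
  destruct (rad_mvt F G 0 t H Ht) as [c [Hc E]].
  assert (Hc0 := oh_incr G F (odd_homeo_sym F G H) c t ltac:(lra)).
  rewrite rad_0 in H1, E. nra.
Qed.

Lemma rad_ge_1 F G t : odd_homeo F G -> 1 <= rad G t.
Proof.
  intros H; destruct (Rle_dec 0 t).
  - apply (rad_bounds F); assumption.
  - rewrite -(rad_even F G t H); apply (rad_bounds F); [exact H|lra].
Qed.

(** Links the curve as given, with an inverse that is meaningless outside
    [[0, f b]] and a radius taken at [|t|], to the smooth even function [rad]. *)
Lemma radius_extend (b : R) (f : R -> R) G t : 0 < b -> f 0 = 0 ->
  (forall u v, 0 <= u -> u < v -> v <= b -> f u < f v) ->
  odd_homeo (extend b f) G -> Rabs t <= f b ->
  radius b f (Rabs t) = rad G t.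
Proof.
  intros Hb f0 Hf H Ht.
  transitivity (rad G (Rabs t)).
  - unfold radius, rad; f_equal; apply RInt_ext; intros s Hs.
    assert (Hp := Rabs_pos t). rewrite Rmin_left // Rmax_right // in Hs.
    assert (HG : 0 <= G s <= b).
    { assert (HGF := oh_GF (extend b f) G b H). rewrite extend_eq // in HGF; [|lra].
      assert (HG0 := oh_0 G _ (odd_homeo_sym _ G H)).
      split; [rewrite -HG0|rewrite -HGF]; apply (oh_le G _ _ _ (odd_homeo_sym _ G H)); lra. }
    assert (Es := oh_FG (extend b f) G H s). rewrite extend_eq // in Es.
    (* the epsilon-chosen inverse is a preimage in [0,b], and f is injective there *)
    destruct (epsilon_spec (inhabits 0) (fun x => 0 <= x <= b /\ f x = s)) as [Hr E].
    { exists (G s); split; assumption. }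
    fold (inverse_on b f s) in Hr, E.
    destruct (Rtotal_order (inverse_on b f s) (G s)) as [L|[L|L]]; [|exact L|];
    apply Hf in L; lra.
  - destruct (Rle_dec 0 t).
    + rewrite Rabs_pos_eq //.
    + rewrite Rabs_left; [apply (rad_even (extend b f)), H|lra].
Qed.

(** The part of [|(x, y) - rad(t) (cos t, sin t)|^2] that depends on [t]; see
    [nearest_offset]. *)
Definition offset (G : R -> R) (x y t : R) : R :=
  rad G t ^ 2 - 2 * rad G t * (x * cos t + y * sin t).

Lemma offset_derive F G x y t : odd_homeo F G ->
  is_derive (offset G x y) t
    (2 * (G t * (rad G t - x * cos t - y * sin t) - rad G t * (y * cos t - x * sin t))).
Proof.
  intros H. unfold offset.
  assert (Hr := rad_derive F G t H).
  auto_derive.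
  - repeat split; exists (G t); exact Hr.
  - rewrite (is_derive_unique _ _ _ Hr). ring.
Qed.

Lemma trig_abs_le x y t : Rabs (x * cos t + y * sin t) <= Rabs x + Rabs y.
Proof.
  assert (H1 := COS_bound t). assert (H2 := SIN_bound t).
  unfold Rabs; repeat destruct (Rcase_abs _); nra.
Qed.

(** Comparing with [t = 0] gives [R (R - 4 d) <= 1 + 2 d] for [R = rad G t] as
    soon as [|x|, |y| <= d]; this forces [R] below [rad G eta] for small [d], and
    [R] increases with [|t|]. *)
Lemma minimizer_small F G eta : odd_homeo F G -> 0 < eta ->
  exists d, 0 < d /\ forall x y t, Rabs x < d -> Rabs y < d ->
    offset G x y t <= offset G x y 0 -> Rabs t < eta.
Proof.
  intros H Heta.
  assert (Hm := rad_incr F G 0 eta H ltac:(lra) Heta). rewrite rad_0 in Hm.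
  set (m := rad G eta - 1).
  exists (Rmin (1/4) (m / 7)).
  split; [apply Rmin_pos; unfold m; lra|].
  set (d := Rmin _ _).
  assert (Hd1 : d <= 1/4) by apply Rmin_l.
  assert (Hd2 : d <= m / 7) by apply Rmin_r.
  intros x y t Hx Hy Hmin; apply Rnot_le_lt; intros Ht.
  assert (Hr : 1 + m <= rad G t).
  { assert (E : rad G t = rad G (Rabs t)).
    { unfold Rabs; destruct (Rcase_abs t); [symmetry; apply (rad_even F), H|reflexivity]. }
    rewrite E. unfold m. destruct Ht as [Ht| <-]; [|lra].
    assert (Hi := rad_incr F G eta (Rabs t) H ltac:(lra) Ht). lra. }
  unfold offset in Hmin. rewrite rad_0 cos_0 sin_0 in Hmin.
  assert (Ha := trig_abs_le x y t).
  apply Rabs_le_between in Ha. apply Rabs_def2 in Hx.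
  assert (Hs : x * cos t + y * sin t <= 2 * d)
    by (assert (Hx2 : Rabs x <= d) by (apply Rabs_le; lra); lra).
  clearbody m. set (r := rad G t) in *. set (s := _ + _) in Hs, Hmin. clearbody s r d.
  assert (r * (r - 4 * d) <= 1 + 2 * d) by nra.
  assert ((1 + m) * (1 + m - 4 * d) <= r * (r - 4 * d)) by (apply Rmult_le_compat; lra).
  nra.
Qed.

Lemma minimizer_critical F G x y t B : odd_homeo F G -> Rabs t < B ->
  (forall s, Rabs s <= B -> offset G x y t <= offset G x y s) ->
  G t * (rad G t - x * cos t - y * sin t) = rad G t * (y * cos t - x * sin t).
Proof.
  intros H Ht Hmin. apply Rabs_lt_between in Ht.
  assert (Hd := offset_derive F G x y t H). apply is_derive_Reals in Hd.
  assert (E := deriv_minimum _ (- B) B t (exist _ _ Hd) (proj1 Ht) (proj2 Ht)).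
  cbn in E.
  assert (E' := E (fun s h1 h2 =>
    Hmin s (Rabs_le _ _ (conj (Rlt_le _ _ h1) (Rlt_le _ _ h2))))).
  lra.
Qed.

Lemma sin_abs_le t : Rabs (sin t) <= Rabs t.
Proof.
  replace (sin t) with (sin t - sin 0) by (rewrite sin_0; ring).
  replace t with (t - 0) at 2 by ring.
  destruct (MVT_abs sin cos 0 t) as [c [E _]].
  - intros; apply derivable_pt_lim_sin.
  - rewrite E. assert (Rabs (cos c) <= 1) by (apply Rabs_le, COS_bound).
    assert (Hp := Rabs_pos (t - 0)). nra.
Qed.

Lemma one_minus_cos_bound t : 0 <= 1 - cos t <= t ^ 2 / 2.
Proof.
  assert (Hb := COS_bound t).
  replace t with (2 * (t / 2)) at 2 3 by field.
  rewrite cos_2a_sin.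
  assert (Hs := sin_abs_le (t / 2)).
  apply Rsqr_le_abs_1 in Hs; unfold Rsqr in Hs. nra.
Qed.

(** * Stability of the profile under stretching *)

(** The one-sided form of the limit hypothesis that the proof consumes; [k = 0]
    is the case of general [x] and [k = 1] the case [x = 0]. *)
Definition stretch_stable (k : nat) (F : R -> R) : Prop :=
  forall c eps, 0 < c -> 0 < eps -> exists d, 0 < d /\ forall w, 0 < w < d ->
    F (w + c * w * F w ^ k * (w + F w)) <= (1 + eps) * F w.

Lemma oh_pos F G u : odd_homeo F G -> 0 < u -> 0 < F u.
Proof. intros H Hu; rewrite -(oh_0 F G H); apply (oh_incr F G H), Hu. Qed.

Lemma oh_small F G e : odd_homeo F G -> 0 < e ->
  exists d, 0 < d /\ forall w, w < d -> F w < e.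
Proof.
  intros H He; exists (G e); split.
  - apply (oh_pos G F); [apply odd_homeo_sym, H|exact He].
  - intros w Hw; rewrite -(oh_FG F G H e); apply (oh_incr F G H), Hw.
Qed.

Lemma pow_le_1 s k : 0 <= s <= 1 -> 0 <= s ^ k <= 1.
Proof.
  intros Hs; induction k as [|k IH]; cbn; [lra|nra].
Qed.

Lemma stretch_small F G k c : odd_homeo F G -> 0 < c ->
  exists d, 0 < d /\ forall w, 0 < w < d -> c * F w ^ k * (w + F w) <= 1.
Proof.
  intros H Hc.
  set (e := / (2 * (c + 1))).
  assert (He : 0 < e) by (apply Rinv_0_lt_compat; lra).
  assert (Ee : 2 * (c + 1) * e = 1) by (apply Rinv_r; lra).
  destruct (oh_small F G e H He) as [d [Hd Hs]].
  exists (Rmin d e); split; [apply Rmin_pos; assumption|].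
  intros w Hw.
  assert (L1 := Rmin_l d e). assert (L2 := Rmin_r d e).
  specialize (Hs w ltac:(lra)). assert (Hp := oh_pos F G w H ltac:(lra)).
  assert (He1 : e <= 1) by nra.
  assert (Hk := pow_le_1 (F w) k ltac:(lra)).
  assert (c * F w ^ k <= c) by nra.
  apply Rle_trans with (c * (w + F w)).
  - apply Rmult_le_compat_r; lra.
  - nra.
Qed.

Lemma unstretch F G k c p : odd_homeo F G -> 0 < c -> 0 < p ->
  exists w, 0 < w <= p /\ w + c * w * F w ^ k * (w + F w) = p.
Proof.
  intros H Hc Hp.
  assert (HF : forall w, 0 <= w -> 0 <= F w).
  { intros w Hw; rewrite -(oh_0 F G H); apply (oh_le F G); assumption. }
  assert (Hn : forall w, 0 <= w -> 0 <= c * w * F w ^ k * (w + F w)).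
  { intros w Hw; assert (Hw' := HF w Hw); assert (Hk := pow_le _ k Hw').
    repeat apply Rmult_le_pos; lra. }
  destruct (IVT_gen (fun w => w + c * w * F w ^ k * (w + F w)) 0 p p) as [w [Hw E]].
  - assert (HC : continuity F) by (intros u; apply continuity_pt_filterlim, (oh_cont F G H)).
    intros u.
    apply (continuity_pt_plus id); [apply derivable_continuous_pt, derivable_pt_id|].
    apply (continuity_pt_mult (fun w => c * w * F w ^ k) (fun w => w + F w)).
    + apply (continuity_pt_mult (fun w => c * w) (fun w => F w ^ k)).
      * apply (continuity_pt_scal id), derivable_continuous_pt, derivable_pt_id.
      * apply (continuity_pt_comp F (fun s => s ^ k)); [apply HC|].
        apply derivable_continuous_pt, derivable_pt_pow.
    + apply (continuity_pt_plus id F); [apply derivable_continuous_pt, derivable_pt_id|apply HC].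
  - specialize (Hn p ltac:(lra)). rewrite Rmult_0_r !Rmult_0_l Rplus_0_l.
    rewrite Rmin_left ?Rmax_right; lra.
  - rewrite Rmin_left ?Rmax_right in Hw; try lra.
    exists w; split; [|exact E].
    destruct (Req_dec w 0) as [->|Hw0]; [|lra].
    rewrite Rmult_0_r !Rmult_0_l in E; lra.
Qed.

(** Halving both arguments of [w F(w)^k (w + F(w))] costs a factor [2^(k+2)];
    this is the constant by which the stretching has to exceed the error bound
    when [w] and [F w] are only known up to a factor 2. *)
Lemma stretch_half k C y s w z : 0 < C -> 0 < y -> 0 < s -> y / 2 <= w -> s / 2 <= z ->
  C * y * s ^ k * (y + s) <= 2 ^ (k + 2) * C * w * z ^ k * (w + z).
Proof.
  intros HC Hy Hs Hw Hz.
  replace (C * y * s ^ k * (y + s))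
    with (2 ^ (k + 2) * C * (y / 2) * (s / 2) ^ k * (y / 2 + s / 2)).
  - assert (H2 : 0 < 2 ^ (k + 2)) by (apply pow_lt; lra).
    assert (Hk : 0 <= (s / 2) ^ k) by (apply pow_le; lra).
    assert (HC2 : 0 < 2 ^ (k + 2) * C) by (apply Rmult_lt_0_compat; assumption).
    apply Rmult_le_compat; [|lra| |lra].
    { repeat apply Rmult_le_pos; lra. }
    apply Rmult_le_compat; [|exact Hk| |apply pow_incr; lra].
    { repeat apply Rmult_le_pos; lra. }
    apply Rmult_le_compat_l; lra.
  - rewrite Rpow_mult_distr pow_add.
    replace (2 ^ k * 2 ^ 2 * C * (y / 2) * (s ^ k * (/ 2) ^ k) * (y / 2 + s / 2))
      with ((2 ^ k * (/ 2) ^ k) * (C * y * s ^ k * (y + s))) by field.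
    rewrite -Rpow_mult_distr Rinv_r ?pow1; [ring|lra].
Qed.

(** The core of the argument.  The larger one [p] of [u] and [y] is written as
    [p = w + c w F(w)^k (w + F(w))], so that [F p <= (1 + e) F w].  If the smaller
    one were below [w], then [|u - y| > c w F(w)^k (w + F(w))].  But [w >= p / 2]
    and [F w >= F p / 2], so with [c = 2^(k+2) C] this contradicts the error bound
    ([stretch_half]), even though the bound contains [F u] and not [F y].  Hence the
    smaller one is at least [w], and its image under [F] is at least
    [F p / (1 + e)]. *)
Lemma stretch_transfer F G k C eps : odd_homeo F G -> stretch_stable k F ->
  0 < C -> 0 < eps ->
  exists d, 0 < d /\ forall y u, 0 < y < d -> 0 < u < d ->
    Rabs (u - y) <= C * y * F u ^ k * (y + F u) -> Rabs (F u - F y) <= eps * F y.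
Proof.
  intros H HS HC Heps.
  set (e := Rmin eps 1).
  assert (He : 0 < e) by (apply Rmin_pos; lra).
  assert (He1 : e <= 1) by apply Rmin_r.
  assert (Hee : e <= eps) by apply Rmin_l.
  set (c := 2 ^ (k + 2) * C).
  assert (Hc : 0 < c) by (apply Rmult_lt_0_compat; [apply pow_lt|]; lra).
  destruct (HS c e Hc He) as [d1 [Hd1 H1]].
  destruct (stretch_small F G k c H Hc) as [d2 [Hd2 H2]].
  assert (Key : forall p, 0 < p < Rmin d1 d2 -> exists w, 0 < w < p /\ p / 2 <= w /\
    p - w = c * w * F w ^ k * (w + F w) /\ F p <= (1 + e) * F w).
  { intros p Hp.
    assert (L1 := Rmin_l d1 d2). assert (L2 := Rmin_r d1 d2).
    destruct (unstretch F G k c p H Hc ltac:(lra)) as [w [Hw E]].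
    specialize (H1 w ltac:(lra)). specialize (H2 w ltac:(lra)).
    rewrite E in H1.
    assert (Hq : 0 < c * w * F w ^ k * (w + F w)).
    { assert (Hpos := oh_pos F G w H ltac:(lra)). assert (Hk := pow_lt _ k Hpos).
      assert (Hwp := Rmult_lt_0_compat c w Hc ltac:(lra)).
      assert (Hwk := Rmult_lt_0_compat _ _ Hwp Hk).
      apply Rmult_lt_0_compat; lra. }
    exists w; repeat split; try lra.
    assert (w * (c * F w ^ k * (w + F w)) <= w * 1) by (apply Rmult_le_compat_l; lra).
    lra. }
  exists (Rmin d1 d2); split; [apply Rmin_pos; assumption|].
  intros y u Hy Hu Hyu.
  assert (Fy := oh_pos F G y H ltac:(lra)). assert (Fu := oh_pos F G u H ltac:(lra)).
  assert (Hupper : F u <= (1 + e) * F y).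
  { destruct (Rle_dec u y) as [L|L].
    - apply (oh_le F G) with (1 := H) in L. nra.
    -
      (* here [p = u]; if [y < w] then [u - y > u - w], which is too large *)
      destruct (Key u Hu) as [w [Hw [_ [E Hf]]]].
      assert (w <= y) as Lwy.
      { apply Rnot_lt_le; intros Lyw.
        assert (X := stretch_half k C y (F u) w (F w) HC ltac:(lra) Fu ltac:(lra) ltac:(nra)).
        fold c in X. rewrite Rabs_pos_eq in Hyu; lra. }
      apply (oh_le F G) with (1 := H) in Lwy. nra. }
  assert (Hlower : F y <= (1 + e) * F u).
  { destruct (Rle_dec y u) as [L|L].
    - apply (oh_le F G) with (1 := H) in L. nra.
    -
      (* here [p = y]; as [F u < F y], the estimate [F w >= F u / 2] holds too *)
      destruct (Key y Hy) as [w [Hw [Hw2 [E Hf]]]].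
      assert (Luy : F u < F y) by (apply (oh_incr F G H); lra).
      assert (w <= u) as Lwu.
      { apply Rnot_lt_le; intros Luw.
        assert (X := stretch_half k C y (F u) w (F w) HC ltac:(lra) Fu ltac:(lra) ltac:(nra)).
        fold c in X. rewrite Rabs_minus_sym Rabs_pos_eq in Hyu; lra. }
      apply (oh_le F G) with (1 := H) in Lwu. nra. }
  apply Rabs_le; nra.
Qed.

(** * Estimates at a critical point *)

(** Solving the critical equation for [R (G t - y)] leaves three error terms:
    [G t (x cos t + y sin t)], [R y (1 - cos t)] and [R x sin t].  The crude bound
    [G t <= 4 y] makes them of order [y^2], [y t] and [y t].  When [x = 0] the
    first is of order [y^2 t], the second of order [y t^2] and the third vanishes,
    which gains the factor [t].  Positivity of [t] comes for free, as [G t] has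
    the sign of the right-hand side. *)
Lemma critical_estimate F G k L x y t : odd_homeo F G ->
  k = 0%nat \/ (k = 1%nat /\ L = 0) ->
  0 <= L -> 0 < y -> Rabs x <= L * y -> (L + 1) * y <= 1 / 2 -> (L + 1) * Rabs t <= 1 / 2 ->
  G t * (rad G t - x * cos t - y * sin t) = rad G t * (y * cos t - x * sin t) ->
  0 < t /\ 0 < G t <= 4 * y /\ Rabs (G t - y) <= 4 * (L + 1) * y * t ^ k * (y + t).
Proof.
  intros H Hk HL Hy Hx Hsy Hst E.
  assert (HR := rad_ge_1 F G t H).
  assert (Hcos := one_minus_cos_bound t). assert (Hsin := sin_abs_le t).
  assert (Hxy := trig_abs_le x y t). rewrite (Rabs_pos_eq y) in Hxy; [|lra].
  assert (Hxs : Rabs (x * sin t) <= L * y * Rabs t).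
  { rewrite Rabs_mult; apply Rmult_le_compat; auto using Rabs_pos. }
  assert (Ht2 : t ^ 2 = Rabs t ^ 2) by (rewrite pow2_abs; reflexivity).
  assert (Hta := Rabs_pos t).
  assert (Ht1 : Rabs t <= 1 / 2) by nra.
  assert (Ht22 : t ^ 2 / 2 <= Rabs t / 4) by nra.
  assert (Hnum : y / 4 <= y * cos t - x * sin t <= y * (3 / 2)).
  { apply Rabs_le_between in Hxs. nra. }
  assert (Hden : Rabs (x * cos t + y * sin t) <= rad G t / 2) by lra.
  apply Rabs_le_between in Hden.
  assert (Hu : 0 < G t).
  { apply Rnot_le_lt; intros Hu.
    assert (G t * (rad G t - x * cos t - y * sin t) <= 0) by nra.
    assert (0 < rad G t * (y * cos t - x * sin t)) by nra. lra. }
  assert (Ht : 0 < t).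
  { rewrite -(oh_FG F G H t); apply (oh_pos F G); assumption. }
  rewrite (Rabs_pos_eq t) in Hst Hxs Hta Ht1 Ht22 Hsin; try lra.
  assert (Hu4 : G t <= 4 * y).
  { assert (G t * (rad G t / 2) <= rad G t * (y * (3 / 2))).
    { apply Rle_trans with (G t * (rad G t - x * cos t - y * sin t)); [nra|rewrite E; nra]. }
    nra. }
  split; [exact Ht|split; [split; assumption|]].
  set (r := rad G t) in *.
  assert (ER : r * (G t - y) =
    G t * (x * cos t + y * sin t) - r * (y * (1 - cos t)) - r * (x * sin t)) by lra.
  apply Rmult_le_reg_l with r; [lra|].
  rewrite -{1}(Rabs_pos_eq r); [|lra]. rewrite -Rabs_mult ER.
  destruct Hk as [->|[-> HL0]].
  - assert (A1 : Rabs (G t * (x * cos t + y * sin t)) <= r * (4 * y * ((L + 1) * y))).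
    { rewrite Rabs_mult (Rabs_pos_eq (G t)); [|lra].
      apply Rle_trans with (4 * y * ((L + 1) * y)).
      - apply Rmult_le_compat; try lra. apply Rabs_pos.
      - assert (0 <= 4 * y * ((L + 1) * y)) by (repeat apply Rmult_le_pos; lra). nra. }
    assert (A2 : 0 <= r * (y * (1 - cos t)) <= r * (y * t)).
    { split; [repeat apply Rmult_le_pos; lra|].
      apply Rmult_le_compat_l; [lra|]. apply Rmult_le_compat_l; lra. }
    assert (A3 : Rabs (r * (x * sin t)) <= r * (L * y * t)).
    { rewrite Rabs_mult (Rabs_pos_eq r); [|lra]. apply Rmult_le_compat_l; lra. }
    apply Rabs_le_between in A1. apply Rabs_le_between in A3.
    assert (A4 : 0 <= r * ((L + 1) * y * t)) by (repeat apply Rmult_le_pos; lra).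
    apply Rabs_le; cbn [pow]. lra.
  - subst L. assert (Hx0 : x = 0).
    { apply Rabs_eq_0, Rle_antisym; [lra|apply Rabs_pos]. }
    subst x.
    assert (A1 : Rabs (G t * (0 * cos t + y * sin t)) <= r * (4 * y * (y * t))).
    { rewrite Rmult_0_l Rplus_0_l !Rabs_mult (Rabs_pos_eq (G t)) ?(Rabs_pos_eq y); try lra.
      apply Rle_trans with (4 * y * (y * t)).
      - apply Rmult_le_compat; try lra.
        + apply Rmult_le_pos; [lra|apply Rabs_pos].
        + apply Rmult_le_compat_l; lra.
      - assert (0 <= 4 * y * (y * t)) by (repeat apply Rmult_le_pos; lra). nra. }
    assert (A2 : 0 <= r * (y * (1 - cos t)) <= r * (y * (t * t))).
    { split; [repeat apply Rmult_le_pos; lra|].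
      apply Rmult_le_compat_l; [lra|]. apply Rmult_le_compat_l; [lra|]. cbn in Hcos. nra. }
    assert (A4 : 0 <= r * (y * (t * t))) by (repeat apply Rmult_le_pos; lra).
    assert (A5 : 0 <= r * (y * (y * t))) by (repeat apply Rmult_le_pos; lra).
    apply Rabs_le_between in A1.
    apply Rabs_le; cbn [pow]. lra.
Qed.

Lemma sin_near_id t : 0 <= t <= 1 -> 0 <= t - sin t <= t ^ 2 / 2.
Proof.
  intros [[Ht| <-] Ht1]; [|rewrite sin_0; lra].
  destruct (MVT_cor2 sin cos 0 t Ht) as [c [E Hc]].
  - intros; apply derivable_pt_lim_sin.
  - rewrite sin_0 !Rminus_0_r in E. rewrite E.
    assert (Hcos := one_minus_cos_bound c). nra.
Qed.

(** Since [t <= 2 F y], all terms of order [y t] or [t^2] are [o(F y)]; besides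
    [t - F y] itself these are the only errors, because [rad G t - 1 <= t G t]
    and [G t <= 4 y]. *)
Lemma curve_estimate F G k C eps : odd_homeo F G -> stretch_stable k F -> 0 < C -> 0 < eps ->
  exists d, 0 < d /\ forall y t, 0 < y < d -> 0 < t < d -> 0 < G t <= 4 * y ->
    Rabs (G t - y) <= C * y * t ^ k * (y + t) ->
    Rabs (t - F y) <= eps * F y /\ Rabs (rad G t * cos t - 1) <= eps * F y /\
    Rabs (rad G t * sin t - F y) <= eps * F y.
Proof.
  intros H HS HC Heps.
  set (e := Rmin (eps / 4) 1).
  assert (He : 0 < e) by (apply Rmin_pos; lra).
  assert (He1 : e <= 1) by apply Rmin_r.
  assert (Hee : e <= eps / 4) by apply Rmin_l.
  destruct (stretch_transfer F G k C e H HS HC He) as [d [Hd Ht]].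
  exists (Rmin (d / 4) (Rmin (eps / 20) (1 / 2))); split.
  { repeat apply Rmin_pos; lra. }
  set (d' := Rmin (d / 4) _).
  assert (L1 : d' <= d / 4) by apply Rmin_l.
  assert (L0 : d' <= Rmin (eps / 20) (1 / 2)) by apply Rmin_r.
  assert (L2 := Rmin_l (eps / 20) (1 / 2)). assert (L3 := Rmin_r (eps / 20) (1 / 2)).
  intros y t Hy Htd Hu Hest.
  specialize (Ht y (G t) ltac:(lra) ltac:(lra)).
  rewrite (oh_FG F G H) in Ht. specialize (Ht Hest).
  assert (Fy := oh_pos F G y H ltac:(lra)).
  assert (Ht' := Ht). apply Rabs_le_between in Ht'.
  assert (Htle : t <= 2 * F y) by nra.
  assert (Hr := rad_bounds F G t H ltac:(lra)).
  assert (Hr4 : rad G t - 1 <= 4 * y * t) by nra.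
  assert (Hc := one_minus_cos_bound t). assert (Hs := sin_near_id t ltac:(lra)).
  assert (Hcb := COS_bound t).
  assert (Hmain : 4 * y * t + t ^ 2 <= eps / 2 * F y) by nra.
  repeat split.
  - nra.
  - replace (rad G t * cos t - 1) with ((rad G t - 1) * cos t - (1 - cos t)) by ring.
    assert (Ha : Rabs ((rad G t - 1) * cos t) <= 4 * y * t) by (apply Rabs_le; nra).
    apply Rabs_le_between in Ha. apply Rabs_le; nra.
  - replace (rad G t * sin t - F y)
      with ((rad G t - 1) * sin t - (t - sin t) + (t - F y)) by ring.
    assert (Hsb := SIN_bound t).
    assert (Ha : Rabs ((rad G t - 1) * sin t) <= 4 * y * t) by (apply Rabs_le; nra).
    apply Rabs_le_between in Ha. apply Rabs_le; nra.
Qed.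

(** * Nearest points of the curve *)

Definition approximates (F G : R -> R) (eps y t : R) : Prop :=
  Rabs (t - F y) <= eps * Rabs (F y) /\ Rabs (rad G t * cos t - 1) <= eps * Rabs (F y) /\
  Rabs (rad G t * sin t - F y) <= eps * Rabs (F y).

Lemma minimizer_estimate_pos F G k L B eps : odd_homeo F G -> stretch_stable k F ->
  k = 0%nat \/ (k = 1%nat /\ L = 0) -> 0 <= L -> 0 < B -> 0 < eps ->
  exists d, 0 < d /\ forall x y t, 0 < y < d -> Rabs x <= L * y ->
    (forall s, Rabs s <= B -> offset G x y t <= offset G x y s) ->
    approximates F G eps y t.
Proof.
  intros H HS Hk HL HB Heps.
  destruct (curve_estimate F G k (4 * (L + 1)) eps H HS ltac:(lra) Heps) as [d1 [Hd1 H1]].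
  set (h := / (2 * (L + 1))).
  assert (Hh : 0 < h) by (apply Rinv_0_lt_compat; lra).
  assert (Eh : (L + 1) * h = 1 / 2) by (unfold h; field; lra).
  destruct (minimizer_small F G (Rmin B (Rmin d1 h)) H) as [d2 [Hd2 H2]].
  { repeat apply Rmin_pos; assumption. }
  assert (M1 := Rmin_l B (Rmin d1 h)). assert (M2 := Rmin_r B (Rmin d1 h)).
  assert (M3 := Rmin_l d1 h). assert (M4 := Rmin_r d1 h).
  assert (Hd3 : 0 < d2 / (L + 1)) by (apply Rdiv_lt_0_compat; lra).
  assert (Ed3 : (L + 1) * (d2 / (L + 1)) = d2) by (field; lra).
  exists (Rmin (Rmin d1 h) (d2 / (L + 1))); split.
  { repeat apply Rmin_pos; assumption. }
  assert (M5 := Rmin_l (Rmin d1 h) (d2 / (L + 1))).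
  assert (M6 := Rmin_r (Rmin d1 h) (d2 / (L + 1))).
  intros x y t Hy Hx Hmin.
  assert (Hyd : (L + 1) * y < d2).
  { rewrite -Ed3. apply Rmult_lt_compat_l; lra. }
  assert (HLy : 0 <= L * y) by (apply Rmult_le_pos; lra).
  assert (Ht : Rabs t < Rmin B (Rmin d1 h)).
  { apply (H2 x y); [lra|rewrite Rabs_pos_eq; lra|].
    apply Hmin. rewrite Rabs_R0; lra. }
  assert (Hcrit := minimizer_critical F G x y t B H ltac:(lra) Hmin).
  destruct (critical_estimate F G k L x y t H Hk HL) as [Ht0 [Hu He]]; try lra.
  { nra. } { nra. }
  rewrite (Rabs_pos_eq t) in Ht; [|lra].
  assert (Fy := oh_pos F G y H ltac:(lra)).
  unfold approximates. rewrite (Rabs_pos_eq (F y)); [|lra].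
  apply H1; try assumption; lra.
Qed.

Lemma offset_reflect F G x y t : odd_homeo F G -> offset G x (- y) (- t) = offset G x y t.
Proof.
  intros H; unfold offset; rewrite (rad_even F) // cos_neg sin_neg; ring.
Qed.

Lemma minimizer_estimate F G k L B eps : odd_homeo F G -> stretch_stable k F ->
  k = 0%nat \/ (k = 1%nat /\ L = 0) -> 0 <= L -> 0 < B -> 0 < eps ->
  exists d, 0 < d /\ forall x y t, 0 < Rabs y < d -> Rabs x <= L * Rabs y ->
    (forall s, Rabs s <= B -> offset G x y t <= offset G x y s) ->
    approximates F G eps y t.
Proof.
  intros H HS Hk HL HB Heps.
  destruct (minimizer_estimate_pos F G k L B eps H HS Hk HL HB Heps) as [d [Hd Hpos]].
  exists d; split; [exact Hd|].
  intros x y t Hy Hx Hmin.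
  destruct (Rle_dec 0 y) as [Hy0|Hy0].
  - rewrite Rabs_pos_eq // in Hy Hx. apply (Hpos x); assumption.
  - rewrite Rabs_left in Hy Hx; try lra.
    destruct (Hpos x (- y) (- t)) as [E1 [E2 E3]]; try assumption.
    { intros s Hs. rewrite -(Ropp_involutive s) !(offset_reflect F) //.
      apply Hmin; rewrite Rabs_Ropp; exact Hs. }
    rewrite (oh_odd F G H) Rabs_Ropp in E1 E2 E3.
    rewrite (rad_even F) // in E2 E3. rewrite cos_neg in E2. rewrite sin_neg in E3.
    repeat split; try assumption.
    + rewrite Rabs_minus_sym. replace (F y - t) with (- t - - F y) by ring. exact E1.
    + rewrite Rabs_minus_sym.
      replace (F y - rad G t * sin t) with (rad G t * - sin t - - F y) by ring. exact E3.
Qed.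

Lemma norm_pair (u v : R) : norm ((u, v) : R * R) = sqrt (u ^ 2 + v ^ 2).
Proof.
  change (sqrt (Rabs u ^ 2 + Rabs v ^ 2) = sqrt (u ^ 2 + v ^ 2)).
  rewrite !pow2_abs; reflexivity.
Qed.

Lemma norm_pair_le (u v : R) : norm ((u, v) : R * R) <= Rabs u + Rabs v.
Proof.
  rewrite norm_pair.
  assert (Hu := Rabs_pos u). assert (Hv := Rabs_pos v).
  rewrite -(sqrt_pow2 (Rabs u + Rabs v)); [|lra].
  apply sqrt_le_1_alt. rewrite -(pow2_abs u) -(pow2_abs v). nra.
Qed.

Lemma nearest_offset G x y s t :
  norm (minus ((x, y) : R * R) (rad G t * cos t, rad G t * sin t)) <=
  norm (minus ((x, y) : R * R) (rad G s * cos s, rad G s * sin s)) ->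
  offset G x y t <= offset G x y s.
Proof.
  change (norm ((x - rad G t * cos t, y - rad G t * sin t) : R * R) <=
          norm ((x - rad G s * cos s, y - rad G s * sin s) : R * R) ->
          offset G x y t <= offset G x y s).
  rewrite !norm_pair.
  assert (E : forall t, (x - rad G t * cos t) ^ 2 + (y - rad G t * sin t) ^ 2 =
                        x ^ 2 + y ^ 2 + offset G x y t).
  { intros p; unfold offset. assert (Hp := sin2_cos2 p); unfold Rsqr in Hp.
    replace (rad G p ^ 2)
      with (rad G p ^ 2 * (sin p * sin p + cos p * cos p)) by (rewrite Hp; ring).
    ring. }
  intros Hle; apply sqrt_le_0 in Hle.
  - rewrite !E in Hle; lra.
  - apply Rplus_le_le_0_compat; apply pow2_ge_0.
  - apply Rplus_le_le_0_compat; apply pow2_ge_0.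
Qed.

(** * Asymptotics of the projection *)

Lemma little_o_intro {V : NormedModule R_AbsRing} (e : R -> V) (h : R -> R) :
  (forall eps, 0 < eps -> exists d, 0 < d /\ forall y, 0 < Rabs y < d ->
     0 < Rabs (h y) /\ norm (e y) <= eps * Rabs (h y)) -> little_o e h.
Proof.
  intros Hle. apply is_lim_spec; intros eps.
  destruct (Hle (eps / 2)) as [d [Hd H]]; [apply is_pos_div_2|].
  exists (mkposreal d Hd); intros y Hy Hy0.
  assert (Hyd : Rabs (y - 0) < d) by exact Hy. rewrite Rminus_0_r in Hyd.
  destruct (H y (conj (Rabs_pos_lt y Hy0) Hyd)) as [Hh Hn].
  assert (He := cond_pos eps). assert (Hnn := norm_ge_0 (e y)).
  rewrite Rminus_0_r Rabs_pos_eq.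
  - apply Rle_lt_trans with (eps / 2); [|lra].
    apply Rmult_le_reg_r with (Rabs (h y)); [exact Hh|].
    unfold Rdiv at 1; rewrite Rmult_assoc Rinv_l ?Rmult_1_r //; lra.
  - apply Rdiv_le_0_compat; assumption.
Qed.

(** For small [w] the stretched point stays below [2 w <= b], where [f] and its
    extension coincide. *)
Lemma stretch_stable_extend b f G k : 0 < b -> f 0 = 0 -> odd_homeo (extend b f) G ->
  (forall c : R, filterlim (fun y => f (y + c * y * f y ^ k * (y + f y)) / f y)
     (at_right 0) (locally 1)) ->
  stretch_stable k (extend b f).
Proof.
  intros Hb f0 H Hlim c eps Hc Heps.
  destruct (proj1 (filterlim_locally _ _) (Hlim c) (mkposreal eps Heps)) as [d Hd].
  destruct (stretch_small _ G k c H Hc) as [d1 [Hd1 H1]].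
  assert (Hd0 := cond_pos d).
  exists (Rmin (Rmin d d1) (b / 2)); split; [repeat apply Rmin_pos; lra|].
  assert (M1 := Rmin_l (Rmin d d1) (b / 2)). assert (M2 := Rmin_r (Rmin d d1) (b / 2)).
  assert (M3 := Rmin_l d d1). assert (M4 := Rmin_r d d1).
  intros w Hw.
  assert (Hpos := oh_pos _ G w H ltac:(lra)).
  specialize (H1 w ltac:(lra)).
  assert (Hk := pow_lt _ k Hpos).
  assert (Hs : 0 <= c * w * extend b f w ^ k * (w + extend b f w) <= w).
  { replace (c * w * extend b f w ^ k * (w + extend b f w))
      with (w * (c * extend b f w ^ k * (w + extend b f w))) by ring.
    assert (0 <= c * extend b f w ^ k * (w + extend b f w)).
    { apply Rmult_le_pos; [apply Rmult_le_pos|]; lra. }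
    split; [apply Rmult_le_pos|]; nra. }
  rewrite (extend_eq b f (_ + _)) //; [|lra].
  rewrite extend_eq // in Hpos |- *; [|lra].
  specialize (Hd w).
  assert (Hb1 : Rabs (f (w + c * w * f w ^ k * (w + f w)) / f w - 1) < eps).
  { apply Hd; [|lra]. change (Rabs (w - 0) < d). rewrite Rabs_pos_eq; lra. }
  apply Rabs_lt_between in Hb1.
  replace (f (w + c * w * f w ^ k * (w + f w)))
    with (f (w + c * w * f w ^ k * (w + f w)) / f w * f w) by (field; lra).
  apply Rmult_le_compat_r; lra.
Qed.

(** Both halves of the theorem are instances: [k = 0] with any [L], and [k = 1]
    with [L = 0], i.e. [x = 0]. *)
Lemma projection_asymptotics (b : R) (f : R -> R) (k : nat) (L : R) (Pi : R * R -> R * R)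
  (x t : R -> R) :
  0 < b -> continuous_on (fun u => 0 <= u <= b) f ->
  (forall u v, 0 <= u -> u < v -> v <= b -> f u < f v) -> f 0 = 0 ->
  is_projection (curve_set b f) Pi ->
  (forall c : R, filterlim (fun y => f (y + c * y * f y ^ k * (y + f y)) / f y)
     (at_right 0) (locally 1)) ->
  k = 0%nat \/ (k = 1%nat /\ L = 0) -> 0 <= L ->
  locally 0 (fun y => Rabs (x y) <= L * Rabs y) ->
  (forall y, - f b <= t y <= f b /\ Pi (x y, y) = curve b f (t y)) ->
  little_o (fun y => t y - odd_ext f y) (odd_ext f) /\
  little_o (fun y => minus (Pi (x y, y)) (1, odd_ext f y)) (odd_ext f).
Proof.
  intros Hb Hcont Hincr f0 HPi Hlim Hk HL [dx Hx] Ht.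
  destruct (extend_odd_homeo b f Hb f0 Hcont Hincr) as [G H].
  set (F := extend b f) in *.
  assert (HS := stretch_stable_extend b f G k Hb f0 H Hlim).
  assert (HB : 0 < f b) by (specialize (Hincr 0 b); lra).
  assert (Hcurve : forall s, Rabs s <= f b -> curve b f s = (rad G s * cos s, rad G s * sin s)).
  { intros s Hs; unfold curve; rewrite (radius_extend b f G s) //. }
  assert (Htb : forall y, Rabs (t y) <= f b) by (intros y; apply Rabs_le, Ht).
  assert (Hest : forall eps, 0 < eps -> exists d, 0 < d /\ forall y, 0 < Rabs y < d ->
    odd_ext f y = F y /\ 0 < Rabs (F y) /\ approximates F G eps y (t y)).
  { intros eps Heps.
    destruct (minimizer_estimate F G k L (f b) eps H HS Hk HL HB Heps) as [d [Hd Hmin]].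
    assert (Hdx := cond_pos dx).
    exists (Rmin (Rmin d dx) b); split; [repeat apply Rmin_pos; assumption|].
    assert (M1 := Rmin_l (Rmin d dx) b). assert (M2 := Rmin_r (Rmin d dx) b).
    assert (M3 := Rmin_l d dx). assert (M4 := Rmin_r d dx).
    intros y Hy; split; [|split; [|]].
    - symmetry; apply extend_odd_ext; lra.
    - apply Rabs_pos_lt; intros E.
      assert (Hy0 : y <> 0) by (intros ->; rewrite Rabs_R0 in Hy; lra).
      apply Hy0. rewrite -(oh_GF F G y H) E; apply (oh_0 G F), odd_homeo_sym, H.
    - apply (Hmin (x y)); [lra| |].
      + apply Hx; change (Rabs (y - 0) < dx); rewrite Rminus_0_r; lra.
      + intros s Hs. apply nearest_offset.
        rewrite -!Hcurve // -(proj2 (Ht y)).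
        apply (proj2 (HPi (x y, y))). exists s; split; [apply Rabs_le_between, Hs|reflexivity]. }
  split; apply little_o_intro; intros eps Heps.
  - destruct (Hest eps Heps) as [d [Hd Hy]]; exists d; split; [exact Hd|].
    intros y Hyd; destruct (Hy y Hyd) as [-> [HF [E _]]]. split; [exact HF|exact E].
  - destruct (Hest (eps / 2) ltac:(lra)) as [d [Hd Hy]]; exists d; split; [exact Hd|].
    intros y Hyd; destruct (Hy y Hyd) as [-> [HF [_ [E1 E2]]]]. split; [exact HF|].
    rewrite (proj2 (Ht y)) Hcurve //.
    apply Rle_trans with (1 := norm_pair_le (rad G (t y) * cos (t y) - 1)
                                            (rad G (t y) * sin (t y) - F y)).
    lra.
Qed.

Theorem proposition3 (b : R) (f : R -> R)
  (b_gt0 : 0 < b)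
  (f_cont : continuous_on (fun u => 0 <= u <= b) f)
  (f_incr : forall u v, 0 <= u -> u < v -> v <= b -> f u < f v)
  (f_0 : f 0 = 0)
  (Pi : R * R -> R * R)
  (Pi_proj : is_projection (curve_set b f) Pi) :
  ((forall c : R,
      filterlim (fun y => f (y + c * y * (y + f y)) / f y) (at_right 0) (locally 1)) ->
   forall x t : R -> R,
     big_O_id x ->
     (forall y, - f b <= t y <= f b /\ Pi (x y, y) = curve b f (t y)) ->
     little_o (fun y => t y - odd_ext f y) (odd_ext f) /\
     little_o (fun y => minus (Pi (x y, y)) (1, odd_ext f y)) (odd_ext f))
  /\
  ((forall c : R,
      filterlim (fun y => f (y + c * y * f y * (y + f y)) / f y) (at_right 0) (locally 1)) ->
   forall t : R -> R,
     (forall y, - f b <= t y <= f b /\ Pi (0, y) = curve b f (t y)) ->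
     little_o (fun y => t y - odd_ext f y) (odd_ext f) /\
     little_o (fun y => minus (Pi (0, y)) (1, odd_ext f y)) (odd_ext f)).
Proof.
  split.
  - intros Hlim x t [L HL] Ht.
    apply (projection_asymptotics b f 0 (Rabs L) Pi x t); try assumption.
    + intros c; apply filterlim_ext with (2 := Hlim c).
      intros y; cbn [pow]; rewrite Rmult_1_r; reflexivity.
    + left; reflexivity.
    + apply Rabs_pos.
    + apply filter_imp with (2 := HL); intros y Hy.
      apply Rle_trans with (1 := Hy), Rmult_le_compat_r; [apply Rabs_pos|apply Rle_abs].
  - intros Hlim t Ht.
    apply (projection_asymptotics b f 1 0 Pi (fun _ => 0) t); try assumption.
    + intros c; apply filterlim_ext with (2 := Hlim c).
      intros y; rewrite pow_1; reflexivity.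
    + right; split; reflexivity.
    + lra.
    + apply filter_forall; intros y; rewrite Rabs_R0; lra.
Qed.
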